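(* Let $G,H\in\mathbb{CR}$. If $G=0$, then $G$ is identically $0$ (that is, $G$ is the position $\{\,\cdot\mid\cdot\mid\cdot\,\}$ with no moves for either player). Moreover, if $G+H=0$, then $G=H=0$.
   Context: Short cr-games (Cheating Robot games). The set $\mathbb{CR}$ of short cr-games (positions) is defined recursively. A position $G$ consists of a finite list $G(L)$ of $m\ge 0$ Left moves $G(i,\cdot)$, a finite list $G(R)$ of $n\ge 0$ Right moves $G(\cdot,j)$, and, for each $i$ a Left option $G^{i,\cdot}$, for each $j$ a Right option $G^{\cdot,j}$, and for each pair $(i,j)$ a same-round option $G^{i,j}$, all options being previously constructed positions. One writes $G=\{G^L\mid S(G)\mid G^R\}$, where $G^L$, $G^R$ are the lists of Left and Right options and $S(G)$ is the $m\times n$ matrix with entries $G^{i,j}$ ($S(G)=\emptyset$ if $m=0$ or $n=0$). The base case is $0=\{\,\cdot\mid\cdot\mid\cdot\,\}$ (no moves); a dot denotes an empty list. Outcomes. Play proceeds in rounds: from $G$, Left chooses a move $G(i,\cdot)$; then Right, knowing Left's choice, chooses $G(\cdot,j)$; the new position is $G^{i,j}$. If $S(G)=\emptyset$: $o(G)=\mathcal L$ (Left wins) if $G(L)\ne\emptyset$; $o(G)=\mathcal R$ (Right wins) if $G(R)\neq\emptyset$; otherwise $o(G)=\mathcal D$ (draw). If $S(G)\ne\emptyset$: $o(G)=\mathcal L$ if Left can force a win, $o(G)=\mathcal R$ if Right can force a win, otherwise $o(G)=\mathcal D$. Outcomes are totally ordered by $\mathcal L>\mathcal D>\mathcal R$.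 Disjunctive sum. $G+H$ has Left moves $G(i,\cdot)+H$ and $G+H(k,\cdot)$ with Left options $G^{i,\cdot}+H$ and $G+H^{k,\cdot}$; Right moves $G(\cdot,j)+H$ and $G+H(\cdot,l)$ with Right options $G^{\cdot,j}+H$ and $G+H^{\cdot,l}$; and same-round options $G^{i,j}+H$ (both move in $G$), $G+H^{k,l}$ (both move in $H$), $G^{i,\cdot}+H^{\cdot,l}$ (Left in $G$, Right in $H$), $G^{\cdot,j}+H^{k,\cdot}$ (Left in $H$, Right in $G$). Equality. For $G,H\in\mathbb{CR}$: $G=H$ if $o(G+X)=o(H+X)$ for all $X\in\mathbb{CR}$. *)

(* Defs.v *)
From mathcomp Require Import all_boot.

Set Implicit Arguments.
Unset Strict Implicit.
Unset Printing Implicit Defensive.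

(* [CRGame L R M]: the lists of Left and Right moves are indexed by ['I_m] and
   ['I_n].  The matrix [M] has no entries when [m = 0] or [n = 0].  Since
   options are given as functions, Leibniz equality of positions is identity
   of positions under functional extensionality. *)
Inductive cr : Type :=
  CRGame (m n : nat) (L : 'I_m -> cr) (R : 'I_n -> cr) (M : 'I_m -> 'I_n -> cr).

Definition no_entry (T : Type) (i : 'I_0) : T :=
  match notF (ltn_ord i) return T with end.

Definition cr0 : cr :=
  CRGame (@no_entry cr) (@no_entry cr) (@no_entry ('I_0 -> cr)).

Definition num_left (G : cr) : nat := let: CRGame m _ _ _ _ := G in m.
Definition num_right (G : cr) : nat := let: CRGame _ n _ _ _ := G in n.

Definition no_round (G : cr) : bool := (num_left G == 0) || (num_right G == 0).

Inductive outcome_class : Type := LeftWin | Draw | RightWin.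

(* In each round Left moves first and Right answers knowing Left's move, hence
   the order of the quantifiers.  Play stops when one of the players has no
   move; a player who still has a move then wins. *)
Fixpoint left_forces (G : cr) : bool :=
  let: CRGame m n _ _ M := G in
  if (m == 0) || (n == 0) then 0 < m
  else [exists i : 'I_m, [forall j : 'I_n, left_forces (M i j)]].

Fixpoint right_forces (G : cr) : bool :=
  let: CRGame m n _ _ M := G in
  if (m == 0) || (n == 0) then 0 < n
  else [forall i : 'I_m, [exists j : 'I_n, right_forces (M i j)]].

Definition outcome (G : cr) : outcome_class :=
  if no_round G then
    if 0 < num_left G then LeftWin
    else if 0 < num_right G then RightWin
    else Draw
  else if left_forces G then LeftWin
  else if right_forces G then RightWin
  else Draw.

(* [split] tells whether a move of the sum is a move in [G] ([inl]) or in [H]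
   ([inr]).  The inner fixpoint [addG] is [cr_add G]. *)
Fixpoint cr_add (G : cr) : cr -> cr :=
  fix addG (H : cr) : cr :=
    match G, H with
    | CRGame m n GL GR GS, CRGame p q HL HR HS =>
      CRGame
        (fun a : 'I_(m + p) =>
           match split a with
           | inl i => cr_add (GL i) H
           | inr k => addG (HL k)
           end)
        (fun b : 'I_(n + q) =>
           match split b with
           | inl j => cr_add (GR j) H
           | inr l => addG (HR l)
           end)
        (fun (a : 'I_(m + p)) (b : 'I_(n + q)) =>
           match split a, split b with
           | inl i, inl j => cr_add (GS i j) H
           | inr k, inr l => addG (HS k l)
           | inl i, inr l => cr_add (GL i) (HR l)
           | inr k, inl j => cr_add (GR j) (HL k)
           end)
    end.

Definition cr_eq (G H : cr) : Prop :=
  forall X : cr, outcome (cr_add G X) = outcome (cr_add H X).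

(* Main.v *)
Require Import Defs.
From mathcomp Require Import all_boot.
From Stdlib Require Import FunctionalExtensionality.

(** Every position [G] other than [cr0] is told apart from [cr0] by some
    position [X].

    If [G] has a Left move and no Right move, take [X = cr0]: Left wins [G] at
    once, while [cr0] is a draw.

    If [G] has a Right move, take for [X] a position [decoy k] with one move for
    each player.  When both players move in [decoy k], Left wins; when just one
    of them does, [decoy k] becomes [right_moves k], which is [k] spare moves
    for Right.  Alone, [decoy k] is a win for Left.  In [G + decoy k] Right, who
    replies knowing Left's move, avoids Left's component: a Left move in
    [decoy k] is answered in [G], and a Left move in [G] is answered in
    [decoy k].  Either way an option of [G] is left beside [k] spare moves for
    Right.  From there Right spends one spare move each round, so only Left
    moves in the option of [G]; for [k] large enough Left runs out of moves
    ([left_forces_right_movesF]) and cannot win.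

    Hence a position equal to [cr0] has no moves ([cr_eq_cr0_identical]).  If
    [G + H] equals [cr0], then it has no moves, so neither [G] nor [H] has one,
    and both are [cr0]. *)

Lemma cr_no_moves (G : cr) : num_left G = 0 -> num_right G = 0 -> G = cr0.
Proof.
case: G => m n L R M /= m0 n0; move: L R M; rewrite m0 n0 => L R M.
by congr CRGame; apply: functional_extensionality => -[].
Qed.

Lemma num_left_add (G H : cr) :
  num_left (cr_add G H) = num_left G + num_left H.
Proof. by case: G => m n L R M; case: H. Qed.

Lemma num_right_add (G H : cr) :
  num_right (cr_add G H) = num_right G + num_right H.
Proof. by case: G => m n L R M; case: H. Qed.

Lemma split0n (n : nat) (a : 'I_(0 + n)) : split a = inr a.
Proof. by case: splitP => [[] // | k ak]; congr inr; apply: val_inj. Qed.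

Lemma cr_add0 (X : cr) : cr_add cr0 X = X.
Proof.
elim: X => p q L IHL R IHR M IHM /=.
congr CRGame; apply: functional_extensionality => a.
- by rewrite split0n; apply: IHL.
- by rewrite split0n; apply: IHR.
- by apply: functional_extensionality => b; rewrite !split0n; apply: IHM.
Qed.

Lemma outcome_LeftWin (G : cr) : outcome G = LeftWin <-> left_forces G.
Proof.
case: G => m n L R M; rewrite /outcome /no_round /=.
case: (_ || _); first by case: (0 < m); case: (0 < n).
case: ifP => _; first by split.
by case: ifP => _; split.
Qed.

Lemma cr_eq_left_forces (G H X : cr) :
  cr_eq G H -> left_forces (cr_add G X) = left_forces (cr_add H X).
Proof.
by move=> eqGH; apply/idP/idP => /outcome_LeftWin oX; apply/outcome_LeftWin;
  rewrite -oX eqGH.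
Qed.

(** This also covers the positions where a player has no move: without Left
    moves Left does not win, and without Right moves the hypothesis leaves no
    Left move. *)
Lemma left_forcesF (G : cr) :
  (let: CRGame m n _ _ M := G in
   forall i : 'I_m, exists j : 'I_n, ~~ left_forces (M i j)) ->
  ~~ left_forces G.
Proof.
case: G => m n L R M reply /=.
case: ifP => [/orP[/eqP m0 | /eqP n0] | _].
- by rewrite m0.
- apply/negP => m_gt0.
  have [j _] := reply (Ordinal m_gt0).
  by have := leq_ltn_trans (leq0n j) (ltn_ord j); rewrite n0.
- apply/existsPn => i; have [j notM] := reply i.
  by apply/forallPn; exists j.
Qed.

Fixpoint right_moves (k : nat) : cr :=
  if k is k'.+1 then
    CRGame (@no_entry cr) (fun _ : 'I_1 => right_moves k')
      (@no_entry ('I_1 -> cr))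
  else cr0.

(** The length of the longest run of consecutive Left moves, with no Right move
    in between. *)
Fixpoint left_height (G : cr) : nat :=
  let: CRGame m _ L _ _ := G in \max_(i < m) (left_height (L i)).+1.

Lemma left_height_option (m n : nat) (L : 'I_m -> cr) (R : 'I_n -> cr)
    (M : 'I_m -> 'I_n -> cr) (i : 'I_m) :
  left_height (L i) < left_height (CRGame L R M).
Proof. exact: (leq_bigmax (F := fun i => (left_height (L i)).+1)). Qed.

(** Right always replies with a spare move, so Left's successive moves in [G]
    form a run without Right moves, of length at most [left_height G]; Left is
    then the one without a move. *)
Lemma left_forces_right_movesF (G : cr) (k : nat) :
  left_height G <= k -> ~~ left_forces (cr_add G (right_moves k)).
Proof.
elim: G k => m n L IHL R _ M _ k.
case: k => [|k] le_k; apply: left_forcesF => a;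
  case: (split a) => [i|[] //];
  have lt_i := leq_trans (left_height_option _ _ L R M i) le_k.
- by [].
- exists (rshift n ord0); rewrite (unsplitK (inr ord0)).
  exact: IHL.
Qed.

Definition decoy (k : nat) : cr :=
  CRGame (fun _ : 'I_1 => right_moves k) (fun _ : 'I_1 => right_moves k)
    (fun _ _ => CRGame (fun _ : 'I_1 => cr0) (@no_entry cr)
                  (fun _ => @no_entry cr)).

Lemma left_forces_decoy (k : nat) : left_forces (decoy k).
Proof. by apply/existsP; exists ord0; apply/forallP. Qed.

(** Right replies in the component that Left did not play in.  The bound on [k]
    has to cover both resulting positions: a Left option of [G], and the
    Right option that Right picks. *)
Lemma left_forces_add_decoyF (G : cr) :
  0 < num_right G -> exists k, ~~ left_forces (cr_add G (decoy k)).
Proof.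
case: G => m n L R M n_gt0; pose j := Ordinal n_gt0 : 'I_n.
pose k := maxn (left_height (CRGame L R M)) (left_height (R j)).
exists k; apply: left_forcesF => a; case: (split a) => [i | _].
- exists (rshift n ord0); rewrite (unsplitK (inr ord0)).
  apply: left_forces_right_movesF.
  by rewrite leq_max (ltnW (left_height_option _ _ L R M i)).
- exists (lshift 1 j); rewrite (unsplitK (inl j)).
  by apply: left_forces_right_movesF; apply: leq_maxr.
Qed.

Lemma left_forces_no_right (G : cr) :
  num_right G = 0 -> left_forces G = (0 < num_left G).
Proof. by case: G => m n L R M /= /eqP ->; rewrite orbT. Qed.

Lemma cr_eq_cr0_identical (G : cr) : cr_eq G cr0 -> G = cr0.
Proof.
move=> G0.
have right0 : num_right G = 0.
  apply/eqP; rewrite -leqn0 leqNgt; apply/negP => /left_forces_add_decoyF[k].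
  by rewrite (cr_eq_left_forces _ _ _ G0) cr_add0 left_forces_decoy.
apply: cr_no_moves => //; apply/eqP; rewrite -leqn0 leqNgt.
have := cr_eq_left_forces _ _ cr0 G0.
rewrite !left_forces_no_right ?num_left_add ?num_right_add ?right0 //.
by rewrite addn0 => ->.
Qed.

Theorem corollary1 (G H : cr) :
  (cr_eq G cr0 -> G = cr0) /\
  (cr_eq (cr_add G H) cr0 -> cr_eq G H /\ cr_eq H cr0).
Proof.
split; first exact: cr_eq_cr0_identical.
move=> /cr_eq_cr0_identical GH0.
have /eqP := num_left_add G H; have /eqP := num_right_add G H.
rewrite GH0 /= ![0 == _]eq_sym !addn_eq0.
move=> /andP[/eqP rG /eqP rH] /andP[/eqP lG /eqP lH].
by rewrite (cr_no_moves G lG rG) (cr_no_moves H lH rH).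
Qed.
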